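(* (Volume conservation and energy stability.) Let $q\in\{0,1\}$, $\eta>0$, $\sigma\in\mathbb R$, and suppose $(\vec X(\cdot,t),\mu(\cdot,t))\in\mathbb X\times H^1(\mathbb I)$, $t\in[0,T]$, with $\vec X=(r,z)^\top$, is a solution of the following variational formulation: for all $t$, $$\left\langle r\,\partial_t\vec X\cdot\vec n,\ \varphi\,|\partial_\rho\vec X|\right\rangle-\left\langle r\,\partial_\rho\mu,\ \partial_\rho\varphi\,|\partial_\rho\vec X|^{-1}\right\rangle=0\qquad\forall\varphi\in H^1(\mathbb I),$$ and, for all $\vec\psi=(\psi_1,\psi_2)^\top\in\mathbb X$, $$\left\langle r\mu\,\vec n,\ \vec\psi\,|\partial_\rho\vec X|\right\rangle+\left\langle r\,\boldsymbol B_q(\theta)\,\partial_\rho\vec X,\ \partial_\rho\vec\psi\,|\partial_\rho\vec X|^{-1}\right\rangle+\left\langle\gamma(\theta),\ \psi_1|\partial_\rho\vec X|\right\rangle+\frac1\eta\left[r_L\,\partial_t r_L\,\psi_1(1)+r_0\,\partial_t r_0\,\psi_1(0)\right]-\sigma\left[r_L\psi_1(1)-r_0\psi_1(0)\right]=0,$$ where $r_0=r(\rho=0,t)$ and $r_L=r(\rho=1,t)$. Then $$\operatorname{vol}(\vec X(t))\equiv\operatorname{vol}(\vec X(0)),\qquad W(t)\le W(t_1)\le W(0)\qquad\text{for } t\ge t_1\ge0 .$$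
   Context: $\mathbb I=[0,1]$; $\langle\cdot,\cdot\rangle$ is the $L^2$ inner product over $\mathbb I$ with respect to $d\rho$ (for scalar or vector functions). $H^1_0(\mathbb I)$ is the subspace of $H^1(\mathbb I)$ of functions vanishing at $0$ and $1$, and $\mathbb X=H^1(\mathbb I)\times H^1_0(\mathbb I)$. $\vec X(\rho,t)=(r(\rho,t),z(\rho,t))^\top$ parametrizes the generating curve of an axisymmetric surface, with radial distance $r\ge0$ and $|\partial_\rho\vec X|>0$. The solution is understood to be regular enough for the formulation and time differentiation to make sense: $\vec X,\partial_\rho\vec X,\partial_t\vec X,\partial_\rho\partial_t\vec X$ are continuous on $\mathbb I\times[0,T]$. The angle $\theta$ (mod $2\pi$) is defined by $\partial_\rho\vec X/|\partial_\rho\vec X|=(\cos\theta,\sin\theta)^\top$, and $\vec n=(-\sin\theta,\cos\theta)^\top$. $\gamma=\gamma(\theta)>0$ is the surface energy density, a $C^2$, even, $2\pi$-periodic function. $\mathscr S(\theta)$ is a given real-valued ($2\pi$-periodic) stability function. For $q\in\{0,1\}$, $$\boldsymbol{B}_q(\theta)=\begin{pmatrix}\gamma(\theta)&-\gamma'(\theta)\\ \gamma'(\theta)&\gamma(\theta)\end{pmatrix}\begin{pmatrix}\cos2\theta&\sin2\theta\\ \sin2\theta&-\cos2\theta\end{pmatrix}^{1-q}+\mathscr S(\theta)\left[\frac12\boldsymbol I-\frac12\begin{pmatrix}\cos2\theta&\sin2\theta\\ \sin2\theta&-\cos2\theta\end{pmatrix}\right],$$ with $\boldsymbol I$ the $2\times2$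 identity matrix. Enclosed volume and total free energy: $$\operatorname{vol}(\vec X(t))=2\pi\int_{\mathbb I} r\,z\,\partial_\rho r\,d\rho,\qquad W(t)=2\pi\int_{\mathbb I} r\,\gamma(\theta)\,|\partial_\rho\vec X|\,d\rho+\sigma\pi\,(r_0^2-r_L^2).$$ *)

(* Defs.v *)
From HB Require Import structures.
From mathcomp Require Export all_boot all_order all_algebra.
From mathcomp Require Export all_classical all_reals all_analysis.
Set Implicit Arguments.
Unset Strict Implicit.
Unset Printing Implicit Defensive.
Import Order.TTheory GRing.Theory Num.Theory.
Import numFieldNormedType.Exports.
Local Open Scope classical_set_scope.
Local Open Scope ring_scope.

(* The norm which the library puts on matrices is the sup norm, so the
   Euclidean structure of the plane is set up separately. *)
Definition vec2 (R : realType) (a b : R) : 'cV[R]_2 :=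
  \col_(i < 2) (if i == 0 then a else b).

Definition mat2 (R : realType) (a b c d : R) : 'M[R]_2 :=
  \matrix_(i < 2, j < 2)
    (if i == 0 then (if j == 0 then a else b) else (if j == 0 then c else d)).

Definition dotv (R : realType) (u v : 'cV[R]_2) : R :=
  \sum_(i < 2) u i 0 * v i 0.

Definition enorm (R : realType) (u : 'cV[R]_2) : R := Num.sqrt (dotv u u).

Definition unitI (R : realType) : set R := `[0, 1]%classic.
Arguments unitI {R}.

Definition ip (R : realType) (f g : R -> R) : R :=
  \int[@lebesgue_measure R]_(x in unitI) (f x * g x).

Definition ipv (R : realType) (f g : R -> 'cV[R]_2) : R :=
  \int[@lebesgue_measure R]_(x in unitI) dotv (f x) (g x).

Definition inL2 (R : realType) (u : R -> R) : Prop :=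
  (u \_ unitI) \in Lfun (@lebesgue_measure R) 2%:E.

Definition smooth (R : realType) (f : R -> R) : Prop :=
  forall n x, derivable (derive1n n f) x 1.

Definition test_function (R : realType) (f : R -> R) : Prop :=
  let supp := closure [set x | f x != 0] in
  [/\ smooth f, compact supp & supp `<=` `]0, 1[%classic].

(* [du] is a representative of the weak derivative of [u]; it is unique up to
   a null set. *)
Definition weak_deriv (R : realType) (u du : R -> R) : Prop :=
  inL2 du /\
  forall f : R -> R, test_function f -> ip u (derive1 f) = - ip du f.

(* A class in H^1(0,1) has exactly one representative that is continuous on
   [0,1]; elements of H^1 are identified with it, so that boundary values are
   values of the function. *)
Definition inH1 (R : realType) (u : R -> R) : Prop :=
  [/\ {within unitI, continuous u}, inL2 u & exists du, weak_deriv u du].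

Definition inH10 (R : realType) (u : R -> R) : Prop :=
  [/\ inH1 u, u 0 = 0 & u 1 = 0].

(* Derivative relative to [D]; one-sided at the endpoints of an interval. *)
Definition diff_quot (R : realType) (f : R -> R) (x : R) : R -> R :=
  fun y => (f y - f x) / (y - x).

Definition derivable_within (R : realType) (D : set R) (f : R -> R) (x : R) :
    Prop :=
  cvg (diff_quot f x y @[y --> within D x^']).

Definition deriv_within (R : realType) (D : set R) (f : R -> R) (x : R) : R :=
  lim (diff_quot f x y @[y --> within D x^']).

Definition d_rho (R : realType) (f : R -> R -> R) (rho t : R) : R :=
  deriv_within unitI (f ^~ t) rho.

Definition d_t (R : realType) (T : R) (f : R -> R -> R) (rho t : R) : R :=
  deriv_within `[0, T]%classic (f rho) t.

Definition continuous_on_box (R : realType) (T : R) (f : R -> R -> R) : Prop :=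
  {within unitI `*` `[0, T]%classic, continuous (fun p : R * R => f p.1 p.2)}.

Definition regular (R : realType) (T : R) (f : R -> R -> R) : Prop :=
  (forall rho t, rho \in `[0, 1] -> t \in `[0, T] ->
     [/\ derivable_within unitI (f ^~ t) rho,
         derivable_within `[0, T]%classic (f rho) t
       & derivable_within unitI ((d_t T f) ^~ t) rho]) /\
  [/\ continuous_on_box T f, continuous_on_box T (d_rho f),
      continuous_on_box T (d_t T f) & continuous_on_box T (d_rho (d_t T f))].

Definition X_rho (R : realType) (r z : R -> R -> R) (rho t : R) : 'cV[R]_2 :=
  vec2 (d_rho r rho t) (d_rho z rho t).

Definition X_t (R : realType) (T : R) (r z : R -> R -> R) (rho t : R) :
    'cV[R]_2 :=
  vec2 (d_t T r rho t) (d_t T z rho t).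

Definition normal (R : realType) (theta : R) : 'cV[R]_2 :=
  vec2 (- sin theta) (cos theta).

Definition reflection (R : realType) (theta : R) : 'M[R]_2 :=
  mat2 (cos (2 * theta)) (sin (2 * theta)) (sin (2 * theta)) (- cos (2 * theta)).

Definition surface_matrix (R : realType) (q : nat) (gamma S : R -> R)
    (theta : R) : 'M[R]_2 :=
  mat2 (gamma theta) (- derive1 gamma theta) (derive1 gamma theta) (gamma theta)
    *m (reflection theta ^+ (1 - q))
  + S theta *: (2^-1 *: 1%:M - 2^-1 *: reflection theta).

(* The angle is only determined modulo 2 pi: [theta] is an arbitrary
   selection. *)
Definition tangent_angle (R : realType) (T : R) (r z theta : R -> R -> R) :
    Prop :=
  forall rho t, rho \in `[0, 1] -> t \in `[0, T] ->
    (enorm (X_rho r z rho t))^-1 *: X_rho r z rho t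
    = vec2 (cos (theta rho t)) (sin (theta rho t)).

(* Quantifying over all representatives of the weak derivatives of [mu(t)] and
   [phi] is harmless, since the integrals do not depend on the choice. *)
Definition kinematic_eq (R : realType) (T : R) (r z theta mu : R -> R -> R)
    (t : R) : Prop :=
  forall phi dphi dmu : R -> R,
    inH1 phi -> weak_deriv phi dphi -> weak_deriv (mu ^~ t) dmu ->
    ip (fun rho => r rho t * dotv (X_t T r z rho t) (normal (theta rho t)))
       (fun rho => phi rho * enorm (X_rho r z rho t))
    - ip (fun rho => r rho t * dmu rho)
         (fun rho => dphi rho * (enorm (X_rho r z rho t))^-1)
    = 0.

Definition dynamic_eq (R : realType) (q : nat) (gamma S : R -> R)
    (eta sigma T : R) (r z theta mu : R -> R -> R) (t : R) : Prop :=
  forall psi1 psi2 dpsi1 dpsi2 : R -> R,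
    inH1 psi1 -> weak_deriv psi1 dpsi1 ->
    inH10 psi2 -> weak_deriv psi2 dpsi2 ->
    ipv (fun rho => (r rho t * mu rho t) *: normal (theta rho t))
        (fun rho => enorm (X_rho r z rho t) *: vec2 (psi1 rho) (psi2 rho))
    + ipv (fun rho => r rho t *:
             (surface_matrix q gamma S (theta rho t) *m X_rho r z rho t))
          (fun rho => (enorm (X_rho r z rho t))^-1 *:
             vec2 (dpsi1 rho) (dpsi2 rho))
    + ip (fun rho => gamma (theta rho t))
         (fun rho => psi1 rho * enorm (X_rho r z rho t))
    + eta^-1 * (r 1 t * d_t T r 1 t * psi1 1 + r 0 t * d_t T r 0 t * psi1 0)
    - sigma * (r 1 t * psi1 1 - r 0 t * psi1 0)
    = 0.

Record weak_solution (R : realType) (q : nat) (gamma S : R -> R)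
    (eta sigma T : R) (r z theta mu : R -> R -> R) : Prop := WeakSolution {
  sol_regular_r : regular T r;
  sol_regular_z : regular T z;
  sol_r_ge0 : forall rho t, rho \in `[0, 1] -> t \in `[0, T] -> 0 <= r rho t;
  sol_nondegenerate : forall rho t, rho \in `[0, 1] -> t \in `[0, T] ->
    0 < enorm (X_rho r z rho t);
  sol_angle : tangent_angle T r z theta;
  sol_r_H1 : forall t, t \in `[0, T] -> inH1 (r ^~ t);
  sol_z_H10 : forall t, t \in `[0, T] -> inH10 (z ^~ t);
  sol_mu_H1 : forall t, t \in `[0, T] -> inH1 (mu ^~ t);
  sol_kinematic : forall t, t \in `[0, T] -> kinematic_eq T r z theta mu t;
  sol_dynamic : forall t, t \in `[0, T] ->
    dynamic_eq q gamma S eta sigma T r z theta mu t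
}.

Definition volume (R : realType) (r z : R -> R -> R) (t : R) : R :=
  2 * pi * \int[@lebesgue_measure R]_(rho in unitI)
             (r rho t * z rho t * d_rho r rho t).

Definition energy (R : realType) (gamma : R -> R) (sigma : R)
    (r z theta : R -> R -> R) (t : R) : R :=
  2 * pi * \int[@lebesgue_measure R]_(rho in unitI)
             (r rho t * gamma (theta rho t) * enorm (X_rho r z rho t))
  + sigma * pi * (r 0 t ^+ 2 - r 1 t ^+ 2).

Definition C2 (R : realType) (f : R -> R) : Prop :=
  [/\ forall x, derivable f x 1, forall x, derivable (derive1 f) x 1
    & continuous (derive1n 2 f)].

(* Main.v *)
Require Import Defs.
From mathcomp Require Import all_boot all_order all_algebra.
From mathcomp Require Import all_classical all_reals all_analysis.
From mathcomp Require Import measurable_realfun ring lra.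
Set Implicit Arguments.
Unset Strict Implicit.
Unset Printing Implicit Defensive.
Import Order.TTheory GRing.Theory Num.Theory.
Import numFieldNormedType.Exports.
Local Open Scope classical_set_scope.
Local Open Scope ring_scope.

(** Both quantities are integrals over [0,1] whose integrands are C^1 in time,
    so they can be differentiated under the integral sign, and the weak
    formulation evaluates the derivatives.

    Volume.  The time derivative of r z r_rho is the normal flux
    r (z_t r_rho - r_t z_rho), which equals r (X_t . n) |X_rho|, plus the exact
    derivative (r z r_t)_rho; the latter integrates to 0 because z vanishes at
    both ends, and the integral of the flux is 0 by the kinematic equation
    tested with phi = 1.

    Energy.  The integrand is r times gamma(theta) |X_rho|, a function of the
    vector X_rho that is homogeneous of degree one and whose gradient at
    |X_rho| (cos theta, sin theta) is gamma tau + gamma' n, where tau and n are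
    the unit tangent and normal.  The tangent is fixed by the reflection in
    B_q(theta) and killed by the stabilising term, so B_q(theta) X_rho is
    |X_rho| times that same gradient.  Hence the rate of change of the integral
    term of the energy is 2 pi times the sum of the second and third terms of
    the dynamic equation tested with psi = X_t, and the rate of change of the
    sigma term matches its last one.  That equation then gives
      W' / (2 pi) = - (mu, r X_t . n |X_rho|)
                    - (r_L r_L'^2 + r_0 r_0'^2) / eta,
    and the kinematic equation tested with phi = mu turns the first term into
    - (r mu_rho, mu_rho / |X_rho|) <= 0.

    Three points need care.  Time derivatives of X_rho are wanted while only
    the rho-derivatives of X_t are given: a double mean value argument
    ([is_derive_t_d_rho]) exchanges them.  The angle theta is an arbitrary
    selection, possibly discontinuous: it is replaced near a reference angle
    theta_0 by theta_0 + asin (sin (theta - theta_0)), which is as regular as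
    the tangent and gives gamma the same value ([periodic_local_angle]).  The
    test functions 1 and X_t must lie in H^1 with the weak derivatives used
    above ([C1_weak_deriv]).

    Derivatives in time are taken at interior times only; continuity of the
    two integrals on [0,T] carries the conclusions to the end points. *)

(** * The surface energy matrix on the tangent *)

Lemma enorm_vec2 (R : realType) (a b : R) :
  enorm (vec2 a b) = Num.sqrt (a ^+ 2 + b ^+ 2).
Proof. by rewrite /enorm /dotv !big_ord_recl big_ord0 !mxE /= addr0. Qed.

Lemma dotv_vec2 (R : realType) (a b c d : R) :
  dotv (vec2 a b) (vec2 c d) = a * c + b * d.
Proof. by rewrite /dotv !big_ord_recl big_ord0 !mxE /= addr0. Qed.

Lemma scale_vec2 (R : realType) (c a b : R) :
  c *: vec2 a b = vec2 (c * a) (c * b).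
Proof. by apply/colP => i; rewrite !mxE; case: ifP. Qed.

Lemma vec2_inj (R : realType) (a b c d : R) :
  vec2 a b = vec2 c d -> a = c /\ b = d.
Proof.
move=> /colP e; split.
- by have := e ord0; rewrite !mxE.
- by have := e (lift ord0 ord0); rewrite !mxE.
Qed.

Lemma mulmx_mat2_vec2 (R : realType) (a b c d x y : R) :
  mat2 a b c d *m vec2 x y = vec2 (a * x + b * y) (c * x + d * y).
Proof.
apply/colP => i; rewrite !mxE !big_ord_recl big_ord0 !mxE /= addr0.
by case: ifP.
Qed.

(** The reflection is the one across the line of direction th. *)
Lemma reflection_tangent (R : realType) (k : nat) (th : R) :
  reflection th ^+ k *m vec2 (cos th) (sin th) = vec2 (cos th) (sin th).
Proof.
have refl1 : reflection th *m vec2 (cos th) (sin th) = vec2 (cos th) (sin th).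
  have -> : reflection th = mat2 (cos (th + th)) (sin (th + th)) (sin (th + th))
      (- cos (th + th)) by rewrite /reflection mulr_natl mulr2n.
  have c2 := cos2Dsin2 th.
  rewrite mulmx_mat2_vec2 cosD sinD; congr vec2.
  - transitivity (cos th * (cos th ^+ 2 + sin th ^+ 2)); first ring.
    by rewrite c2 mulr1.
  - transitivity (sin th * (cos th ^+ 2 + sin th ^+ 2)); first ring.
    by rewrite c2 mulr1.
elim: k => [|k IH]; first by rewrite expr0 mul1mx.
by rewrite exprSr -mulmxE -mulmxA refl1.
Qed.

(** The tangent is fixed by the reflection, so the two halves of the stabilising
    term cancel; what remains is the gradient of the anisotropic length found in
    [is_derive_anisotropic_length]. *)
Lemma surface_matrix_tangent (R : realType) (q : nat) (g S : R -> R) (th : R) :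
  surface_matrix q g S th *m vec2 (cos th) (sin th)
  = vec2 (g th * cos th - derive1 g th * sin th)
         (derive1 g th * cos th + g th * sin th).
Proof.
rewrite /surface_matrix mulmxDl -mulmxA reflection_tangent.
rewrite -[X in _ + X]scalemxAl mulmxBl -!scalemxAl mul1mx.
have := reflection_tangent 1 th; rewrite expr1 => ->; rewrite subrr scaler0 addr0.
by rewrite mulmx_mat2_vec2 mulNr.
Qed.

(** * One-sided derivatives and mean values *)

Lemma derivable_within_is_derive (R : realType) (a b : R) (f : R -> R) (x : R) :
  x \in `]a, b[ -> derivable_within `[a, b] f x ->
  is_derive x 1 f (deriv_within `[a, b] f x).
Proof.
move=> xab; rewrite /derivable_within /deriv_within.
set l := lim _ => cf.
have fl : h^-1 *: ((f \o shift x) (h *: 1) - f x) @[h --> 0^'] --> l.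
  apply/cvgrPdist_le => /= e e0.
  move/cvgrPdist_le : (cf) => /(_ e e0) /= [d d0 H].
  have [d' /= d'0 Hab] := near_in_itvoo xab.
  exists (Num.min d d') => /=; first by rewrite lt_min d0.
  move=> h /=; rewrite sub0r normrN lt_min => /andP[hd hd'] h0.
  have := H (h + x); rewrite /= /diff_quot /shift /= addrK scaler1.
  rewrite opprD addrCA subrr addr0 normrN mulrC; apply => //.
    by rewrite -subr_eq0 addrK.
  apply: subset_itv_oo_cc; apply: Hab => /=.
  by rewrite opprD addrCA subrr addr0 normrN.
apply: DeriveDef; first by apply/cvg_ex; exists l.
by apply/cvg_lim.
Qed.

(** Stated without ordering x and y, so that increments towards either end of
    the interval, and null ones, are treated alike. *)
Lemma MVT_between (R : realType) (a b : R) (f df : R -> R) :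
  {within `[a, b], continuous f} ->
  (forall x, x \in `]a, b[ -> is_derive x 1 f (df x)) ->
  forall x y, x \in `[a, b] -> y \in `[a, b] ->
  exists c, [/\ c \in `[a, b], `|c - x| <= `|y - x|
    & f y - f x = df c * (y - x)].
Proof.
move=> cf df_ x y xab yab.
have key u v : u \in `[a, b] -> v \in `[a, b] -> u < v ->
    exists c, [/\ c \in `[a, b], u <= c, c <= v & f v - f u = df c * (v - u)].
  move=> uab vab uv.
  have [au vb] : a <= u /\ v <= b by rewrite (itvP uab) (itvP vab).
  have sub : `[u, v] `<=` `[a, b] by apply: subset_itvScc; rewrite bnd_simp.
  have subo w : w \in `]u, v[ -> w \in `]a, b[.
    by apply: subset_itvSoo; rewrite bnd_simp.
  have [c cuv E] := MVT uv (fun w wuv => df_ w (subo w wuv))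
    (continuous_subspaceW sub cf).
  exists c; split => //; rewrite ?(itvP cuv)//.
  by apply: subset_itv_oo_cc; exact: subo.
case: (ltgtP x y) => [xy|yx|<-].
- have [c [cab xc cy E]] := key _ _ xab yab xy.
  by exists c; split => //; rewrite !ger0_norm ?subr_ge0 ?(ltW xy)// lerD2r.
- have [c [cab yc cx E]] := key _ _ yab xab yx.
  exists c; split => //; last by rewrite -[LHS]opprB E -mulrN opprB.
  by rewrite !ler0_norm ?subr_le0 ?(ltW yx)// lerN2 lerD2r.
- by exists x; split => //; rewrite !subrr mulr0.
Qed.

(** A quotient-free criterion, which mean value estimates meet directly. *)
Lemma is_derive_near_affine (R : realType) (g : R -> R) (t l : R) :
  (forall e, 0 < e ->
    \forall s \near t, `|g s - g t - l * (s - t)| <= e * `|s - t|) ->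
  is_derive t 1 g l.
Proof.
move=> H.
have gl : h^-1 *: ((g \o shift t) (h *: 1) - g t) @[h --> 0^'] --> l.
  apply/cvgrPdist_le => /= e e0.
  have [d /= d0 Hd] := H e e0.
  exists d => //= h; rewrite /= sub0r normrN => hd h0.
  have := Hd (h + t); rewrite /= opprD addrCA subrr addr0 normrN => /(_ hd).
  rewrite addrK scaler1 /shift /= => {}Hd.
  set D := g (h + t) - g t in Hd *.
  have -> : l - h^-1 *: D = - (D - l * h) / h.
    by rewrite /GRing.scale/=; field.
  by rewrite normrM normfV normrN ler_pdivrMr ?normr_gt0.
apply: DeriveDef; first by apply/cvg_ex; exists l.
by apply/cvg_lim.
Qed.

Lemma within_itv_dnbhs_proper (R : realType) (a b x : R) :
  a < b -> x \in `[a, b] -> ProperFilter (within `[a, b] x^').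
Proof.
move=> ab xab; apply: Build_ProperFilter_ex => P /= [d /= d0 H].
have [ax xleb] : a <= x /\ x <= b by rewrite !(itvP xab).
have [xb|bx] := ltP x b.
- pose y := x + Num.min (d / 2) (b - x).
  have m0 : 0 < Num.min (d / 2) (b - x) by rewrite lt_min divr_gt0 ?subr_gt0.
  exists y; apply: H => /=.
  + rewrite /y opprD addrA subrr sub0r normrN gtr0_norm// gt_min.
    by rewrite ltr_pdivrMr// ltr_pMr// ltr1n.
  + by rewrite /y -subr_eq0 addrAC subrr add0r gt_eqF.
  + rewrite in_itv/= /y; apply/andP; split.
      by rewrite (le_trans ax)// lerDl ltW.
    by rewrite -lerBrDl ge_min lexx orbT.
- have xb : x = b by apply/eqP; rewrite eq_le bx xleb.
  pose y := x - Num.min (d / 2) (b - a).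
  have m0 : 0 < Num.min (d / 2) (b - a) by rewrite lt_min divr_gt0 ?subr_gt0.
  exists y; apply: H => /=.
  + rewrite /y opprB addrCA subrr addr0 gtr0_norm// gt_min.
    by rewrite ltr_pdivrMr// ltr_pMr// ltr1n.
  + by rewrite /y -subr_eq0 addrAC subrr add0r oppr_eq0 gt_eqF.
  + rewrite in_itv/= /y xb; apply/andP; split.
      by rewrite lerBrDl -lerBrDr ge_min lexx orbT.
    by rewrite lerBlDr lerDl ltW.
Qed.

(** * Continuity on the space-time box *)

Lemma box_continuous_dist (R : realType) (T : R) (f : R -> R -> R) (x t e : R) :
  continuous_on_box T f -> x \in `[0, 1] -> t \in `[0, T] -> 0 < e ->
  exists2 d, 0 < d & forall y s, y \in `[0, 1] -> s \in `[0, T] ->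
    `|y - x| < d -> `|s - t| < d -> `|f y s - f x t| <= e.
Proof.
move=> /subspace_continuousP cf x01 tT e0.
have /cvgrPdist_le /(_ e e0) [[U V] /= [[d1 /= d10 Ud] [d2 /= d20 Vd]] H] :=
  cf (x, t) (conj x01 tT).
exists (Num.min d1 d2) => [|y s y01 sT]; first by rewrite lt_min d10.
rewrite !lt_min => /andP[yx _] /andP[_ st]; rewrite distrC.
by apply: (H (y, s)) => //; split => /=;
  [apply: Ud|apply: Vd]; rewrite /= distrC.
Qed.

Lemma box_continuous_rho (R : realType) (T : R) (f : R -> R -> R) (t : R) :
  continuous_on_box T f -> t \in `[0, T] -> {within unitI, continuous (f ^~ t)}.
Proof.
move=> cf tT; apply/subspace_continuousP => x x01.
apply/cvgrPdist_le => /= e e0.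
have [d d0 H] := box_continuous_dist cf x01 tT e0.
exists d => //= y yx y01; rewrite distrC; apply: H => //.
  by rewrite distrC.
by rewrite subrr normr0.
Qed.

Lemma box_continuous_t (R : realType) (T : R) (f : R -> R -> R) (x : R) :
  continuous_on_box T f -> x \in `[0, 1] -> {within `[0, T], continuous (f x)}.
Proof.
move=> cf x01; apply/subspace_continuousP => t tT.
apply/cvgrPdist_le => /= e e0.
have [d d0 H] := box_continuous_dist cf x01 tT e0.
exists d => //= s st sT; rewrite distrC; apply: H => //.
  by rewrite subrr normr0.
by rewrite distrC.
Qed.

Lemma box_continuous_bounded (R : realType) (T : R) (f : R -> R -> R) :
  continuous_on_box T f ->
  exists2 M, 0 <= M & forall x t, x \in `[0, 1] -> t \in `[0, T] -> `|f x t| <= M.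
Proof.
move=> cf.
have cbox : compact (@unitI R `*` `[0, T]%classic).
  by apply: compact_setX; exact: segment_compact.
have [M [_ HM]] := compact_bounded (continuous_compact cf cbox).
exists (`|M| + 1) => [|x t x01 tT]; first by rewrite addr_ge0.
apply: (HM (`|M| + 1)); first by rewrite ltr_pwDr// ler_norm.
by exists (x, t).
Qed.

Lemma box_continuous_eq (R : realType) (T : R) (f g : R -> R -> R) :
  (forall x t, x \in `[0, 1] -> t \in `[0, T] -> f x t = g x t) ->
  continuous_on_box T f -> continuous_on_box T g.
Proof.
move=> fg; apply: subspace_eq_continuous => -[x t] /set_mem [/= x01 tT].
exact: fg.
Qed.

Lemma box_continuousD (R : realType) (T : R) (f g : R -> R -> R) :
  continuous_on_box T f -> continuous_on_box T g ->
  continuous_on_box T (fun x t => f x t + g x t).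
Proof. by move=> cf cg p; apply: continuousD; [exact: cf|exact: cg]. Qed.

Lemma box_continuousB (R : realType) (T : R) (f g : R -> R -> R) :
  continuous_on_box T f -> continuous_on_box T g ->
  continuous_on_box T (fun x t => f x t - g x t).
Proof. by move=> cf cg p; apply: continuousB; [exact: cf|exact: cg]. Qed.

Lemma box_continuousM (R : realType) (T : R) (f g : R -> R -> R) :
  continuous_on_box T f -> continuous_on_box T g ->
  continuous_on_box T (fun x t => f x t * g x t).
Proof. by move=> cf cg p; apply: continuousM; [exact: cf|exact: cg]. Qed.

Lemma box_continuous_div (R : realType) (T : R) (f g : R -> R -> R) :
  (forall x t, x \in `[0, 1] -> t \in `[0, T] -> g x t != 0) ->
  continuous_on_box T f -> continuous_on_box T g ->
  continuous_on_box T (fun x t => f x t / g x t).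
Proof.
move=> g0 /subspace_continuousP cf /subspace_continuousP cg.
apply/subspace_continuousP => -[x t] [/= x01 tT].
apply: cvgM; first exact: (cf (x, t)).
by apply: cvgV; [exact: g0|exact: (cg (x, t))].
Qed.

Lemma box_continuous_enorm (R : realType) (T : R) (a b : R -> R -> R) :
  continuous_on_box T a -> continuous_on_box T b ->
  continuous_on_box T (fun x t => enorm (vec2 (a x t) (b x t))).
Proof.
move=> ca cb; have /subspace_continuousP c := box_continuousD
  (box_continuousM ca ca) (box_continuousM cb cb).
apply: (@box_continuous_eq _ _ (fun x t =>
    Num.sqrt (a x t * a x t + b x t * b x t))) => [x t _ _|].
  by rewrite enorm_vec2 !expr2.
apply/subspace_continuousP => p pB.
by apply: cvg_comp (c p pB) _; exact: sqrt_continuous.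
Qed.

(** * Exchanging the derivatives in space and time *)

Lemma regular_is_derive_rho (R : realType) (T : R) (f : R -> R -> R) (x t : R) :
  regular T f -> x \in `]0, 1[ -> t \in `[0, T] ->
  is_derive x 1 (f ^~ t) (d_rho f x t).
Proof.
move=> [Df _] x01 tT; apply: derivable_within_is_derive => //.
by have [] := Df x t (subset_itv_oo_cc x01) tT.
Qed.

Lemma regular_is_derive_t (R : realType) (T : R) (f : R -> R -> R) (x t : R) :
  regular T f -> x \in `[0, 1] -> t \in `]0, T[ ->
  is_derive t 1 (f x) (d_t T f x t).
Proof.
move=> [Df _] x01 tT; apply: derivable_within_is_derive => //.
by have [] := Df x t x01 (subset_itv_oo_cc tT).
Qed.

Lemma regular_is_derive_rho_t (R : realType) (T : R) (f : R -> R -> R) (x t : R) :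
  regular T f -> x \in `]0, 1[ -> t \in `[0, T] ->
  is_derive x 1 ((d_t T f) ^~ t) (d_rho (d_t T f) x t).
Proof.
move=> [Df _] x01 tT; apply: derivable_within_is_derive => //.
by have [] := Df x t (subset_itv_oo_cc x01) tT.
Qed.

(** The mean value theorem in t for f y - f x, then in rho for the time
    derivative of f. *)
Lemma mixed_difference (R : realType) (T : R) (f : R -> R -> R) (x y s t : R) :
  regular T f ->
  x \in `[0, 1] -> y \in `[0, 1] -> s \in `[0, T] -> t \in `[0, T] ->
  exists xi tau, [/\ xi \in `[0, 1], tau \in `[0, T],
    `|xi - x| <= `|y - x|, `|tau - t| <= `|s - t|
    & (f y s - f x s) - (f y t - f x t)
      = d_rho (d_t T f) xi tau * (y - x) * (s - t)].
Proof.
move=> rf x01 y01 sT tT; have [_ [cf _ cft _]] := rf.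
have [|u uT|tau [tauT tauts Etau]] := @MVT_between R 0 T (fun s => f y s - f x s)
  (fun s => d_t T f y s - d_t T f x s) _ _ t s tT sT.
- move=> u; apply: continuousB; exact: box_continuous_t.
- by apply: is_deriveB; exact: regular_is_derive_t.
have [|u u01|xi [xi01 xixy Exi]] := @MVT_between R 0 1 ((d_t T f) ^~ tau)
  ((d_rho (d_t T f)) ^~ tau) _ _ x y x01 y01.
- exact: box_continuous_rho.
- exact: regular_is_derive_rho_t.
by exists xi, tau; split => //; rewrite Etau Exi.
Qed.

(** Divide [mixed_difference] by y - x and let y tend to x: the increment of
    d_rho f in time is within e |s - t| of the linear one, by continuity of
    d_rho (d_t f).  Existence of the other mixed derivative is a conclusion. *)
Lemma is_derive_t_d_rho (R : realType) (T : R) (f : R -> R -> R) (x t : R) :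
  regular T f -> x \in `[0, 1] -> t \in `]0, T[ ->
  is_derive t 1 (d_rho f x) (d_rho (d_t T f) x t).
Proof.
move=> rf x01 toT; have [Df [_ _ _ cfrt]] := rf.
have tT : t \in `[0, T] by exact: subset_itv_oo_cc.
apply: is_derive_near_affine => e e0.
have [d d0 Hd] := box_continuous_dist cfrt x01 tT e0.
have [d' /= d'0 HT] := near_in_itvoo toT.
exists (Num.min d d') => /=; first by rewrite lt_min d0.
move=> s /=; rewrite lt_min => /andP[sd sd'].
have sT : s \in `[0, T] by apply: subset_itv_oo_cc; exact: HT.
have PF := @within_itv_dnbhs_proper R 0 1 x ltr01 x01.
pose q y := diff_quot (f ^~ s) x y - diff_quot (f ^~ t) x y
  - d_rho (d_t T f) x t * (s - t).
have cq : q y @[y --> within `[0, 1] x^'] -->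
    d_rho f x s - d_rho f x t - d_rho (d_t T f) x t * (s - t).
  apply: cvgB; last exact: cvg_cst.
  by apply: cvgB; [have [] := Df x s x01 sT|have [] := Df x t x01 tT].
(* the bound holds for the quotients q y and is preserved in the limit *)
have cl : closed [set u : R | `|u| <= e * `|s - t|].
  apply: (@preimage_closed _ _ (fun u : R => `|u|) [set u | u <= e * `|s - t|]).
    by move=> u _; exact: norm_continuous.
  exact: closed_le.
apply: (closed_cvg _ cl _ _ cq).
exists d => //= y; rewrite /ball_/= distrC => yx yneq y01.
have [xi [tau [xi01 tauT xix taut E]]] := mixed_difference rf x01 y01 sT tT.
have -> : q y = (d_rho (d_t T f) xi tau - d_rho (d_t T f) x t) * (s - t).
  by rewrite /q /diff_quot -mulrBl E mulrAC mulfK ?subr_eq0// -mulrBl.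
rewrite normrM ler_wpM2r// Hd//; first exact: le_lt_trans xix yx.
by rewrite (le_lt_trans taut)// distrC.
Qed.

(** * Differentiation under the integral sign *)

Lemma continuous_unitI_integrable (R : realType) (u : R -> R) :
  {within unitI, continuous u} ->
  (@lebesgue_measure R).-integrable unitI (EFin \o u).
Proof. by apply: continuous_compact_integrable; exact: segment_compact. Qed.

Lemma measurable_unitI (R : realType) :
  measurable (unitI : set (measurableTypeR R)).
Proof. exact: measurable_itv. Qed.

Lemma Rintegral_unitI_cst (R : realType) (c : R) :
  \int[@lebesgue_measure R]_(x in unitI) c = c.
Proof.
rewrite Rintegral_cst; last exact: measurable_unitI.
by rewrite [X in fine X]lebesgue_measure_itv /= lte_fin ltr01 oppr0 adde0 mulr1.
Qed.

Section leibniz.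
Variables (R : realType) (T : R) (F Ft : R -> R -> R).
Hypotheses (cF : continuous_on_box T F) (cFt : continuous_on_box T Ft).
Hypothesis dF : forall x t, x \in `[0, 1] -> t \in `]0, T[ ->
  is_derive t 1 (F x) (Ft x t).

Let J t := \int[@lebesgue_measure R]_(x in unitI) F x t.

Let intF t : t \in `[0, T] ->
  (@lebesgue_measure R).-integrable unitI (EFin \o (F ^~ t)).
Proof.
by move=> tT; apply: continuous_unitI_integrable; exact: box_continuous_rho tT.
Qed.

(** The integral is Lipschitz in t, with the bound of [Ft] as constant. *)
Lemma leibniz_continuous : {within `[0, T], continuous J}.
Proof.
have [M M0 HM] := box_continuous_bounded cFt.
have mI := @measurable_unitI R.
have Jlip s t : s \in `[0, T] -> t \in `[0, T] ->
    `|J s - J t| <= M * `|s - t|.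
  move=> sT tT; rewrite /J -(RintegralB mI (intF sT) (intF tT)).
  have intB := integrableB mI (intF sT) (intF tT).
  apply: le_trans (le_normr_Rintegral _ _) _ => //.
  apply: (@le_trans _ _ (\int[@lebesgue_measure R]_(x in unitI) (M * `|s - t|))).
    apply: le_Rintegral => //.
    - exact: integrable_norm.
    - apply: continuous_unitI_integrable; apply: continuous_subspaceT => ?.
      exact: cvg_cst.
    - move=> x x01.
      have [tau [tauT _ ->]] := MVT_between (box_continuous_t cF x01)
        (fun u uT => dF x01 uT) tT sT.
      by rewrite normrM ler_wpM2r// HM.
  by rewrite Rintegral_unitI_cst.
apply/subspace_continuousP => t tT; apply/cvgrPdist_le => /= e e0.
exists (e / (M + 1)) => /= [|s st sT]; first by rewrite divr_gt0// ltr_wpDl.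
apply: le_trans (Jlip _ _ tT sT) _.
apply: (@le_trans _ _ ((M + 1) * `|t - s|)).
  by rewrite ler_wpM2r// lerDl.
by rewrite mulrC -ler_pdivlMr ?ltr_wpDl// ltW.
Qed.

Lemma leibniz_is_derive t : t \in `]0, T[ ->
  is_derive t 1 J (\int[@lebesgue_measure R]_(x in unitI) Ft x t).
Proof.
move=> tT; have [M M0 HM] := box_continuous_bounded cFt.
have mI := @measurable_unitI R.
have int_ s : `]0, T[%classic s ->
    (@lebesgue_measure R).-integrable unitI (EFin \o F ^~ s).
  by move=> sT; apply: intF; exact: subset_itv_oo_cc.
have der s x : `]0, T[%classic s -> unitI x -> derivable (F x) s 1.
  by move=> sT x01; have [] := dF x01 sT.
have derE s x : `]0, T[%classic s -> unitI x ->
    partial1of2 (fun s x => F x s) s x = Ft x s.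
  by move=> sT x01; rewrite partial1of2E; have [] := dF x01 sT.
have intM : (@lebesgue_measure R).-integrable unitI (EFin \o cst M).
  apply: continuous_unitI_integrable; apply: continuous_subspaceT => ?.
  exact: cvg_cst.
have ub s x : `]0, T[%classic s -> unitI x ->
    `|partial1of2 (fun s x => F x s) s x| <= cst M x.
  move=> sT x01; rewrite derE//; apply: HM => //; exact: subset_itv_oo_cc.
apply: DeriveDef.
  exact: (derivable_under_integral mI tT int_ der (fun=> M0) intM ub).
rewrite -derive1E.
rewrite (differentiation_under_integral mI tT int_ der (fun=> M0) intM ub).
by apply: eq_Rintegral => x /set_mem x01; exact: derE.
Qed.

End leibniz.

(** * Classical derivatives as weak derivatives *)

Lemma continuous_inL2 (R : realType) (u : R -> R) :
  {within unitI, continuous u} -> inL2 u.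
Proof.
move=> cu; have mI := @measurable_unitI R.
have /integrableP[/measurable_EFinP mu _] := continuous_unitI_integrable cu.
apply/andP; split; rewrite inE /=; first exact/(measurable_restrictT _ mI).
rewrite /finite_norm unlock poweR_lty//.
have cu2 : {within unitI, continuous (fun x => u x * u x)}.
  by move=> x; apply: continuousM; exact: cu.
have /integrableP[_] := continuous_unitI_integrable cu2.
congr (_ < _)%E; rewrite [LHS]integral_mkcond; apply: eq_integral => x _.
rewrite /= /patch; case: ifP => _ /=.
  by rewrite powR_mulrn// normrM -expr2.
by change (0%:E = (`|0 : R| `^ 2)%:E); rewrite normr0 powR_mulrn// expr0n.
Qed.

Lemma test_function_boundary (R : realType) (f : R -> R) (x : R) :
  test_function f -> ~ `]0, 1[%classic x -> f x = 0.
Proof.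
move=> [_ _ sf] nx; apply/eqP/negP => /negP fx; apply: nx; apply: sf.
exact: subset_closure.
Qed.

Lemma Rintegral_derive_unitI (R : realType) (u du : R -> R) :
  {within unitI, continuous u} -> {within unitI, continuous du} ->
  (forall x : R, x \in `]0, 1[ -> is_derive x 1 u (du x)) ->
  \int[@lebesgue_measure R]_(x in unitI) du x = u 1 - u 0.
Proof.
move=> cu cdu Du.
have [_ u0 u1] := (continuous_within_itvP u (@ltr01 R)).1 cu.
rewrite /Rintegral (@continuous_FTC2 _ du u 0 1)//.
- by split => // x /Du [].
- by move=> x /Du [_ <-]; rewrite derive1E.
Qed.

(** The product of u with a test function vanishes at 0 and 1, so the integral
    of its derivative is 0. *)
Lemma C1_weak_deriv (R : realType) (u du : R -> R) :
  {within unitI, continuous u} -> {within unitI, continuous du} ->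
  (forall x : R, x \in `]0, 1[ -> is_derive x 1 u (du x)) ->
  weak_deriv u du.
Proof.
move=> cu cdu Du; split; first exact: continuous_inL2.
have mI := @measurable_unitI R.
move=> f tf; have [sf _ _] := tf.
have df (x : R) : is_derive x 1 f (derive1 f x).
  by rewrite derive1E; apply: derivableP; exact: (sf 0%N).
have cf : continuous f.
  move=> x; apply: differentiable_continuous; apply/derivable1_diffP.
  exact: (sf 0%N).
have cdf : continuous (derive1 f).
  move=> x; apply: differentiable_continuous; apply/derivable1_diffP.
  exact: (sf 1%N).
have cf' := @continuous_subspaceT _ _ unitI _ cf.
have cdf' := @continuous_subspaceT _ _ unitI _ cdf.
have c1 : {within unitI, continuous (fun x => u x * derive1 f x)}.
  by move=> x; apply: continuousM; [exact: cu|exact: cdf'].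
have c2 : {within unitI, continuous (fun x => du x * f x)}.
  by move=> x; apply: continuousM; [exact: cdu|exact: cf'].
apply/eqP; rewrite -subr_eq0 opprK /ip.
rewrite -(RintegralD mI (continuous_unitI_integrable c1)
  (continuous_unitI_integrable c2)).
have c12 : {within unitI, continuous (fun x => u x * derive1 f x + du x * f x)}.
  by move=> x; exact: (continuousD (c1 x) (c2 x)).
have cuf : {within unitI, continuous (fun x => u x * f x)}.
  by move=> x; apply: continuousM; [exact: cu|exact: cf'].
have Duf (x : R) : x \in `]0, 1[ ->
    is_derive x 1 (fun x => u x * f x) (u x * derive1 f x + du x * f x).
  move=> /Du Dux; have := is_deriveM Dux (df x).
  by move=> h; apply: is_derive_eq h _; rewrite /GRing.scale/= [f x * _]mulrC.
rewrite (Rintegral_derive_unitI cuf c12 Duf).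
by rewrite !(test_function_boundary tf) ?mulr0 ?subrr//= in_itv/= ltxx ?andbF.
Qed.

Lemma C1_inH1 (R : realType) (u du : R -> R) :
  {within unitI, continuous u} -> {within unitI, continuous du} ->
  (forall x : R, x \in `]0, 1[ -> is_derive x 1 u (du x)) ->
  inH1 u.
Proof.
move=> cu cdu Du; split => //; first exact: continuous_inL2.
by exists du; exact: C1_weak_deriv.
Qed.

Lemma regular_d_t_H1 (R : realType) (T : R) (f : R -> R -> R) (t : R) :
  regular T f -> t \in `[0, T] ->
  inH1 (d_t T f ^~ t) /\ weak_deriv (d_t T f ^~ t) (d_rho (d_t T f) ^~ t).
Proof.
move=> rf tT; have [_ [_ _ cft cfrt]] := rf.
have h := box_continuous_rho cft tT; have h' := box_continuous_rho cfrt tT.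
have D (x : R) : x \in `]0, 1[ ->
    is_derive x 1 (d_t T f ^~ t) (d_rho (d_t T f) x t).
  by move=> x01; exact: regular_is_derive_rho_t.
by split; [exact: C1_inH1 D|exact: C1_weak_deriv].
Qed.

(** * Periodic functions of an angle selection *)

Lemma periodic_int (R : realType) (g : R -> R) (p : R) :
  periodic g p -> forall (n : int) x, g (x + n%:~R * p) = g x.
Proof.
move=> gp [n|n] x; first by rewrite mulr_natl periodicn.
by rewrite NegzE mulNr mulr_natl -(periodicn gp n.+1 (x - _)) subrK.
Qed.

(** After removing the whole turns, e lies in [0, 2 pi[ and |e - pi| lies in
    [0, pi], where cosine is injective and takes the value -1 only at pi. *)
Lemma cos_eq1 (R : realType) (x : R) :
  cos x = 1 -> exists n : int, x = n%:~R * (2 * pi).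
Proof.
move=> cx; pose n := Num.floor (x / (2 * pi)); exists n.
have pi0 : 0 < 2 * pi :> R by rewrite mulr_gt0// pi_gt0.
have /andP[n1 n2] : n%:~R * (2 * pi) <= x < (n%:~R + 1) * (2 * pi).
  by rewrite -ler_pdivlMr// -ltr_pdivrMr// floor_le /= -intrD1 floorD1_gt.
pose e := x - n%:~R * (2 * pi).
have per : periodic (@cos R) (2 * pi) by move=> u; rewrite mulr_natl cosD2pi.
have ce : cos e = 1 by rewrite /e -(periodic_int per n) subrK.
have epi : `|e - pi| = pi.
  apply: cos_inj; rewrite ?in_itv/= ?lexx ?pi_ge0 ?normr_ge0//.
    by rewrite ler_norml; apply/andP; split; rewrite /e; lra.
  by rewrite cos_norm cosB cospi sinpi ce; lra.
have : e = 0.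
  case: (ltrP e pi) => epi'.
  - by move: epi; rewrite ltr0_norm ?subr_lt0//; lra.
  - by move: epi; rewrite ger0_norm ?subr_ge0// /e; lra.
by rewrite /e; lra.
Qed.

Lemma periodic_eq_angle (R : realType) (g : R -> R) (x y : R) :
  periodic g (2 * pi) -> cos x = cos y -> sin x = sin y -> g x = g y.
Proof.
move=> gp cxy sxy.
have [n /eqP] : exists n : int, x - y = n%:~R * (2 * pi).
  by apply: cos_eq1; rewrite cosB cxy sxy -!expr2 cos2Dsin2.
by rewrite subr_eq addrC => /eqP ->; rewrite periodic_int.
Qed.

Lemma asin0 (R : realType) : asin (0 : R) = 0.
Proof.
by rewrite -[in LHS](@sin0 R) sinK// in_itv/= oppr_le0 divr_ge0 ?pi_ge0.
Qed.

(** The right-hand angle depends on x only through sin (x - y), hence inherits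
    the regularity of (cos x, sin x) even when x itself jumps by multiples of
    2 pi.  It agrees with x modulo 2 pi as long as x - y stays in the half plane
    where cosine is nonnegative. *)
Lemma periodic_local_angle (R : realType) (g : R -> R) (x y : R) :
  periodic g (2 * pi) -> 0 <= cos (x - y) -> g x = g (y + asin (sin (x - y))).
Proof.
move=> gp c0; set s := sin (x - y).
have s11 : -1 <= s <= 1 by rewrite sin_geN1 sin_le1.
have ss : sin (asin s) = s by rewrite asinK.
have cs : cos (asin s) = cos (x - y).
  by rewrite cos_asin// /s -cos2sin2 sqrtr_sqr ger0_norm.
have -> : g x = g (y + (x - y)) by rewrite addrC subrK.
apply: periodic_eq_angle => //.
- by rewrite (cosD y (x - y)) (cosD y (asin s)) cs ss.
- by rewrite (sinD y (x - y)) (sinD y (asin s)) cs ss.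
Qed.

(** No convergence of the angles themselves is assumed, only of the directions
    they represent. *)
Lemma periodic_angle_cvg (R : realType) (T : Type) (F : set_system T)
    (g : R -> R) (th : T -> R) (t0 : R) :
  Filter F -> periodic g (2 * pi) -> {for t0, continuous g} ->
  cos (th x) @[x --> F] --> cos t0 -> sin (th x) @[x --> F] --> sin t0 ->
  g (th x) @[x --> F] --> g t0.
Proof.
move=> FF gp cg cth sth.
have c1 : cos (th x - t0) @[x --> F] --> (1 : R).
  have -> : 1 = cos t0 * cos t0 + sin t0 * sin t0 :> R.
    by rewrite -!expr2 cos2Dsin2.
  under eq_fun do rewrite cosB.
  by apply: cvgD; apply: cvgMl.
have s0 : sin (th x - t0) @[x --> F] --> (0 : R).
  have -> : 0 = sin t0 * cos t0 - cos t0 * sin t0 :> R by ring.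
  under eq_fun do rewrite sinB.
  by apply: cvgB; apply: cvgMl.
have e : \forall x \near F, g (t0 + asin (sin (th x - t0))) = g (th x).
  have : \forall x \near F, 0 < cos (th x - t0) by apply: (cvgr_gt 1 c1).
  by apply: filterS => x x0; rewrite (periodic_local_angle gp (ltW x0)).
have a0 : asin (sin (th x - t0)) @[x --> F] --> (0 : R).
  rewrite -(asin0 R); apply: cvg_comp s0 _.
  by apply: continuous_asin; rewrite ltrN10 ltr01.
have al : t0 + asin (sin (th x - t0)) @[x --> F] --> t0.
  by rewrite -{3}[t0]addr0; exact: (cvgD (cvg_cst t0) a0).
apply: cvg_trans (near_eq_cvg e) _.
exact: cvg_comp al cg.
Qed.

(** Chain rule for p |-> gamma(theta) |p| along a curve p = (a, b), where theta
    is any selection of the polar angle of p: the gradient is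
    gamma tau + gamma' n. *)
Lemma is_derive_anisotropic_length (R : realType) (g a b th : R -> R)
    (t da db : R) (N := fun s => Num.sqrt (a s ^+ 2 + b s ^+ 2)) :
  periodic g (2 * pi) -> derivable g (th t) 1 -> 0 < N t ->
  (\forall s \near t, a s = N s * cos (th s) /\ b s = N s * sin (th s)) ->
  is_derive t 1 a da -> is_derive t 1 b db ->
  is_derive t 1 (fun s => g (th s) * N s)
    ((g (th t) * cos (th t) - derive1 g (th t) * sin (th t)) * da
     + (derive1 g (th t) * cos (th t) + g (th t) * sin (th t)) * db).
Proof.
move=> gp dg Nt abN Da Db.
have N2 : 0 < a t ^+ 2 + b t ^+ 2 by rewrite -sqrtr_gt0.
set c0 := cos (th t); set s0 := sin (th t).
have [at_ bt_] := nbhs_singleton abN.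
pose P s := a s ^+ 2 + b s ^+ 2.
have DP : is_derive t 1 P (2 * N t * (c0 * da + s0 * db)).
  apply: is_derive_eq.
  by rewrite /GRing.scale/= at_ bt_ -/c0 -/s0; ring.
have DN : is_derive t 1 N (c0 * da + s0 * db).
  have := @is_derive1_comp _ Num.sqrt P t _ _ (is_derive1_sqrt N2) DP.
  by move=> h; apply: is_derive_eq h _; rewrite -/(N t); field; rewrite gt_eqF.
have asin_d : is_derive (0 : R) 1 asin 1.
  have := @is_derive1_asin R 0; rewrite ltrN10 ltr01 => /(_ isT).
  by rewrite expr0n /= subr0 sqrtr1 invr1.
(* the component of p along the normal at time t, so that V / N is the sine of
   the angle turned since t *)
pose V s := b s * c0 - a s * s0.
have V0 : V t = 0 by rewrite /V at_ bt_ -/c0 -/s0; ring.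
have DV : is_derive t 1 V (db * c0 - da * s0).
  apply: is_derive_eq.
  by rewrite /GRing.scale/=; ring.
have DU : is_derive t 1 (fun s => V s * (N s)^-1) ((db * c0 - da * s0) / N t).
  have := is_deriveM DV (is_deriveV (lt0r_neq0 Nt) DN).
  by move=> h; apply: is_derive_eq h _; rewrite V0 /GRing.scale/=; ring.
set D := (_ / N t) in DU.
(* a differentiable branch of the angle near t *)
pose al s := th t + asin (V s / N s).
have Dal : is_derive t 1 al D.
  have asinVN : is_derive (V t / N t) 1 asin 1 by rewrite V0 mul0r.
  have := @is_derive1_comp R asin (fun s => V s / N s) t _ _ asinVN DU.
  move=> /(is_deriveD (is_derive_cst (th t) t 1)) h.
  by apply: is_derive_eq h _; rewrite add0r mul1r.
have alt_ : al t = th t.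
  by rewrite /al V0 mul0r asin0 addr0.
have Dgal : is_derive t 1 (g \o al) (derive1 g (th t) * D).
  apply: is_derive1_comp => //; rewrite alt_ derive1E; exact: derivableP.
have Dmain : is_derive t 1 ((g \o al) * N)
    ((g (th t) * cos (th t) - derive1 g (th t) * sin (th t)) * da
     + (derive1 g (th t) * cos (th t) + g (th t) * sin (th t)) * db).
  apply: is_derive_eq.
  rewrite /= alt_ /D -/c0 -/s0 /GRing.scale/=; field; rewrite gt_eqF//.
have Nc : {for t, continuous N}.
  by apply: differentiable_continuous; apply/derivable1_diffP; case: DN.
have Vc : {for t, continuous (fun s => a s * c0 + b s * s0)}.
  apply: differentiable_continuous; apply/derivable1_diffP.
  by [].
have e : \forall s \near t, ((g \o al) * N) s = g (th s) * N s.
  have n1 : \forall s \near t, 0 < N s by apply: (cvgr_gt _ Nc).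
  (* p stays in the half plane around its direction at time t, where the branch
     al represents the same angle as th *)
  have n2 : \forall s \near t, 0 < a s * c0 + b s * s0.
    apply: (cvgr_gt _ Vc); rewrite at_ bt_ -/c0 -/s0.
    by rewrite -!mulrA -mulrDr -!expr2 cos2Dsin2 mulr1.
  near=> s; change (g (al s) * N s = g (th s) * N s); rewrite /al.
  have [as_ bs_] : a s = N s * cos (th s) /\ b s = N s * sin (th s) by near: s.
  have Ns : 0 < N s by near: s.
  have -> : V s / N s = sin (th s - th t).
    by rewrite /V as_ bs_ sinB -/c0 -/s0; field; rewrite gt_eqF.
  rewrite -periodic_local_angle//.
  have : 0 < a s * c0 + b s * s0 by near: s.
  rewrite as_ bs_ -!mulrA -mulrDr -cosB pmulr_rgt0//; exact: ltW.
exact: near_eq_is_derive e Dmain.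
Unshelve. all: by end_near. Qed.

Lemma box_continuous_periodic_angle (R : realType) (T : R) (g : R -> R)
    (th : R -> R -> R) :
  periodic g (2 * pi) -> continuous g ->
  continuous_on_box T (fun x t => cos (th x t)) ->
  continuous_on_box T (fun x t => sin (th x t)) ->
  continuous_on_box T (fun x t => g (th x t)).
Proof.
move=> gp cg /subspace_continuousP cc /subspace_continuousP cs.
apply/subspace_continuousP => p pB.
exact: periodic_angle_cvg gp (cg _) (cc p pB) (cs p pB).
Qed.

Lemma periodic_derive1 (R : realType) (g : R -> R) (p : R) :
  periodic g p -> periodic (derive1 g) p.
Proof.
move=> gp x; rewrite /derive1.
have -> // : (fun h => h^-1 *: (g (h + (x + p)) - g (x + p)))
  = (fun h => h^-1 *: (g (h + x) - g x)).
by apply/funext => h; rewrite addrA !gp.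
Qed.

(** * Volume conservation and energy decay *)

Section conservation_and_dissipation.
Variables (R : realType) (q : nat) (gamma S : R -> R).
Variables (eta sigma T : R) (r z theta mu : R -> R -> R).
Hypotheses (eta_gt0 : 0 < eta) (gamma_C2 : C2 gamma).
Hypothesis gamma_periodic : periodic gamma (2 * pi).
Hypothesis hsol : weak_solution q gamma S eta sigma T r z theta mu.

Let I_oo_cc (a b x : R) : x \in `]a, b[ -> x \in `[a, b].
Proof. exact: subset_itv_oo_cc. Qed.

Let rr := sol_regular_r hsol.
Let rz := sol_regular_z hsol.
Let N x t := enorm (X_rho r z x t).
Let c x t := cos (theta x t).
Let s x t := sin (theta x t).
Let g x t := gamma (theta x t).
Let dg x t := derive1 gamma (theta x t).
Let rt := d_t T r.
Let zt := d_t T z.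

Let cr : continuous_on_box T r. Proof. by case: rr => _ []. Qed.
Let cz : continuous_on_box T z. Proof. by case: rz => _ []. Qed.
Let crp : continuous_on_box T (d_rho r). Proof. by case: rr => _ []. Qed.
Let czp : continuous_on_box T (d_rho z). Proof. by case: rz => _ []. Qed.
Let crt : continuous_on_box T rt. Proof. by case: rr => _ []. Qed.
Let czt : continuous_on_box T zt. Proof. by case: rz => _ []. Qed.
Let crpt : continuous_on_box T (d_rho rt). Proof. by case: rr => _ []. Qed.
Let czpt : continuous_on_box T (d_rho zt). Proof. by case: rz => _ []. Qed.

Let N_gt0 x t : x \in `[0, 1] -> t \in `[0, T] -> 0 < N x t.
Proof. exact: (sol_nondegenerate hsol). Qed.

Let N_neq0 x t : x \in `[0, 1] -> t \in `[0, T] -> N x t != 0.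
Proof. by move=> x01 tT; rewrite gt_eqF// N_gt0. Qed.

Let X_rho_polar x t : x \in `[0, 1] -> t \in `[0, T] ->
  d_rho r x t = N x t * c x t /\ d_rho z x t = N x t * s x t.
Proof.
move=> x01 tT; have := sol_angle hsol x01 tT.
rewrite /X_rho scale_vec2 => /vec2_inj[ec es].
by rewrite /c /s -ec -es !mulVKf ?N_neq0.
Qed.

Let cN : continuous_on_box T N.
Proof. exact: box_continuous_enorm. Qed.

Let cc : continuous_on_box T c.
Proof.
apply: box_continuous_eq (box_continuous_div N_neq0 crp cN) => x t x01 tT.
by have [-> _] := X_rho_polar x01 tT; rewrite mulrC mulKf ?N_neq0.
Qed.

Let cs : continuous_on_box T s.
Proof.
apply: box_continuous_eq (box_continuous_div N_neq0 czp cN) => x t x01 tT.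
by have [_ ->] := X_rho_polar x01 tT; rewrite mulrC mulKf ?N_neq0.
Qed.

Let cg : continuous_on_box T g.
Proof.
apply: box_continuous_periodic_angle => //; have [d1 _ _] := gamma_C2.
by move=> x; apply: differentiable_continuous; apply/derivable1_diffP.
Qed.

Let cdg : continuous_on_box T dg.
Proof.
apply: box_continuous_periodic_angle => //; first exact: periodic_derive1.
have [_ d2 _] := gamma_C2.
by move=> x; apply: differentiable_continuous; apply/derivable1_diffP.
Qed.

Let z_boundary x t : x = 0 \/ x = 1 -> t \in `[0, T] -> z x t = 0.
Proof. by move=> + tT; have [_ z0 z1] := sol_z_H10 hsol tT => -[] ->. Qed.

Let zt_boundary x t : x = 0 \/ x = 1 -> t \in `]0, T[ -> zt x t = 0.
Proof.
move=> xb tT; have x01 : x \in `[0, 1].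
  by case: xb => ->; rewrite in_itv/= ?lexx ler01.
rewrite /zt; have [_ <-] := regular_is_derive_t rz x01 tT.
have [d /= d0 H] := near_in_itvoo tT.
have e : \forall u \near t, cst (0 : R) u = z x u.
  by exists d => // u /H uT; rewrite z_boundary//; exact: I_oo_cc.
by have [] := near_eq_is_derive e (is_derive_cst (0 : R) t 1).
Qed.

(** Equal to r (X_t . n) |X_rho|. *)
Let flux x t := r x t * (zt x t * d_rho r x t - rt x t * d_rho z x t).

(** The kinematic equation tested with the constant 1. *)
Lemma normal_velocity_mean0 t : t \in `[0, T] ->
  \int[@lebesgue_measure R]_(x in unitI) flux x t = 0.
Proof.
move=> tT; have [_ _ [dmu Dmu]] := sol_mu_H1 hsol tT.
have c1 : {within unitI, continuous (cst 1 : R -> R)}.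
  by apply: continuous_subspaceT => x; exact: cvg_cst.
have c0 : {within unitI, continuous (cst 0 : R -> R)}.
  by apply: continuous_subspaceT => x; exact: cvg_cst.
have D (x : R) : x \in `]0, 1[ -> is_derive x 1 (cst 1 : R -> R) (cst 0 x).
  by move=> _; exact: is_derive_cst.
have := sol_kinematic hsol tT (C1_inH1 c1 c0 D) (C1_weak_deriv c1 c0 D) Dmu.
rewrite /ip => /eqP; rewrite subr_eq0 => /eqP E.
transitivity (\int[@lebesgue_measure R]_(x in unitI) (r x t *
    dotv (X_t T r z x t) (normal (theta x t)) * (cst 1 x * enorm (X_rho r z x t)))).
  apply: eq_Rintegral => x /set_mem x01.
  rewrite /X_t dotv_vec2 /flux /=; have [-> ->] := X_rho_polar x01 tT.
  by rewrite -/rt -/zt -/(N x t) -/(c x t) -/(s x t); ring.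
rewrite E -[RHS](Rintegral_unitI_cst 0); apply: eq_Rintegral => x _ /=.
by rewrite mul0r mulr0.
Qed.

Let Vint x t := r x t * z x t * d_rho r x t.
Let Vint_t x t := rt x t * z x t * d_rho r x t + r x t * zt x t * d_rho r x t
  + r x t * z x t * d_rho rt x t.

Let cV : continuous_on_box T Vint.
Proof. by do !apply: box_continuousM. Qed.

Let cVt : continuous_on_box T Vint_t.
Proof. by do !(apply: box_continuousD || apply: box_continuousM). Qed.

Let dV x t : x \in `[0, 1] -> t \in `]0, T[ ->
  is_derive t 1 (Vint x) (Vint_t x t).
Proof.
move=> x01 tT; have Dr := regular_is_derive_t rr x01 tT.
have Dz := regular_is_derive_t rz x01 tT; have Drp := is_derive_t_d_rho rr x01 tT.
have := is_deriveM (is_deriveM Dr Dz) Drp => h.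
by apply: is_derive_eq h _; rewrite /Vint_t /GRing.scale/= !fctE -/rt -/zt; ring.
Qed.

(** The integrand is the normal flux plus the rho-derivative of r z r_t, which
    vanishes at both ends with z. *)
Lemma volume_rate0 t : t \in `]0, T[ ->
  \int[@lebesgue_measure R]_(x in unitI) Vint_t x t = 0.
Proof.
move=> otT; have tT := I_oo_cc otT.
pose H x := r x t * z x t * rt x t.
pose dH x := (d_rho r x t * z x t + r x t * d_rho z x t) * rt x t
  + r x t * z x t * d_rho rt x t.
have cH : {within unitI, continuous H}.
  exact: (box_continuous_rho (box_continuousM (box_continuousM cr cz) crt) tT).
have cdH : {within unitI, continuous dH}.
  exact: (box_continuous_rho (box_continuousD (box_continuousM (box_continuousD
    (box_continuousM crp cz) (box_continuousM cr czp)) crt)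
    (box_continuousM (box_continuousM cr cz) crpt)) tT).
have DH (x : R) : x \in `]0, 1[ -> is_derive x 1 H (dH x).
  move=> x01; have Dr := regular_is_derive_rho rr x01 tT.
  have Dz := regular_is_derive_rho rz x01 tT.
  have Drt := regular_is_derive_rho_t rr x01 tT.
  have := is_deriveM (is_deriveM Dr Dz) Drt => h.
  by apply: is_derive_eq h _; rewrite /dH /GRing.scale/= !fctE -/rt; ring.
have cf : {within unitI, continuous (flux ^~ t)}.
  exact: (box_continuous_rho (box_continuousM cr
    (box_continuousB (box_continuousM czt crp) (box_continuousM crt czp))) tT).
transitivity (\int[@lebesgue_measure R]_(x in unitI) (flux x t + dH x)).
  by apply: eq_Rintegral => x _; rewrite /Vint_t /flux /dH; ring.
rewrite RintegralD; [|exact: measurable_itv|exact: continuous_unitI_integrable..].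
rewrite normal_velocity_mean0// add0r (Rintegral_derive_unitI cH cdH DH) /H.
by rewrite !z_boundary ?mulr0 ?mul0r ?subrr; auto.
Qed.

Lemma weak_solution_volume t : t \in `[0, T] -> volume r z t = volume r z 0.
Proof.
move=> tT; congr (2 * pi * _); apply/eqP; rewrite -subr_eq0.
have T0 : 0 \in `[0, T].
  by move: tT; rewrite !in_itv/= lexx => /andP[]; exact: le_trans.
have D u : u \in `]0, T[ -> is_derive u 1
    (fun t => \int[@lebesgue_measure R]_(x in unitI) Vint x t) (cst 0 u).
  by move=> uT; have := leibniz_is_derive cV cVt dV uT; rewrite volume_rate0.
have [u [_ _ ->]] := MVT_between (leibniz_continuous cV cVt dV) D T0 tT.
by rewrite mul0r.
Qed.

(** (A1, A2) is the gradient of the anisotropic length at X_rho. *)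
Let A1 x t := g x t * c x t - dg x t * s x t.
Let A2 x t := dg x t * c x t + g x t * s x t.
Let Eint x t := r x t * (g x t * N x t).
Let Eint_t x t := rt x t * (g x t * N x t)
  + r x t * (A1 x t * d_rho rt x t + A2 x t * d_rho zt x t).

Let cE : continuous_on_box T Eint.
Proof. by do !apply: box_continuousM. Qed.

Let cA1 : continuous_on_box T A1.
Proof. by apply: box_continuousB; apply: box_continuousM. Qed.

Let cA2 : continuous_on_box T A2.
Proof. by apply: box_continuousD; apply: box_continuousM. Qed.

Let cE1 : continuous_on_box T (fun x t => rt x t * (g x t * N x t)).
Proof. by do !apply: box_continuousM. Qed.

Let cE2 : continuous_on_box T (fun x t =>
  r x t * (A1 x t * d_rho rt x t + A2 x t * d_rho zt x t)).
Proof.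
by apply: box_continuousM => //; apply: box_continuousD; apply: box_continuousM.
Qed.

Let cEt : continuous_on_box T Eint_t.
Proof. exact: box_continuousD. Qed.

Let dE x t : x \in `[0, 1] -> t \in `]0, T[ ->
  is_derive t 1 (Eint x) (Eint_t x t).
Proof.
move=> x01 otT; have tT := I_oo_cc otT.
have Dr := regular_is_derive_t rr x01 otT.
have Dgn : is_derive t 1 (fun u => g x u * N x u)
    (A1 x t * d_rho rt x t + A2 x t * d_rho zt x t).
  have [dgamma _ _] := gamma_C2.
  have NE u : N x u = Num.sqrt (d_rho r x u ^+ 2 + d_rho z x u ^+ 2).
    by rewrite /N /X_rho enorm_vec2.
  have -> : (fun u => g x u * N x u) = (fun u => gamma (theta x u) *
      Num.sqrt (d_rho r x u ^+ 2 + d_rho z x u ^+ 2)).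
    by apply/funext => u; rewrite NE.
  apply: (@is_derive_anisotropic_length _ gamma (d_rho r x) (d_rho z x)
    (theta x)) => //.
  - by rewrite -NE N_gt0.
  - have [d /= d0 H] := near_in_itvoo otT.
    exists d => // u /H uT; rewrite -NE; apply: X_rho_polar => //; exact: I_oo_cc.
  - exact: is_derive_t_d_rho.
  - exact: is_derive_t_d_rho.
have := is_deriveM Dr Dgn => h.
apply: is_derive_eq h _.
by rewrite /Eint_t /GRing.scale/= -/rt addrC [X in X + _]mulrC.
Qed.

(** The left-hand side is the rate of change of the energy, divided by 2 pi.  It
    is evaluated by the dynamic equation tested with X_t, whose term in mu is
    signed by the kinematic equation tested with mu. *)
Lemma energy_dissipation t : t \in `]0, T[ ->
  \int[@lebesgue_measure R]_(x in unitI) Eint_t x t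
  - sigma * (r 1 t * rt 1 t - r 0 t * rt 0 t) <= 0.
Proof.
move=> otT; have tT := I_oo_cc otT.
have [_ _ [dmu Dmu]] := sol_mu_H1 hsol tT.
have [rH1 rD] := regular_d_t_H1 rr tT; have [zH1 zD] := regular_d_t_H1 rz tT.
have zH10 : inH10 (zt ^~ t) by split => //; apply: zt_boundary; auto.
have := sol_dynamic hsol tT rH1 rD zH10 zD.
have := sol_kinematic hsol tT (sol_mu_H1 hsol tT) Dmu Dmu.
set K := ip _ _; set K' := ip _ _; move=> /eqP; rewrite subr_eq0 => /eqP KK'.
have K0 : 0 <= K.
  rewrite KK'; apply: Rintegral_ge0 => x x01.
  rewrite (_ : _ * _ = r x t * dmu x ^+ 2 * (N x t)^-1); last by rewrite /N; ring.
  rewrite divr_ge0//; last exact/ltW/N_gt0.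
  by rewrite mulr_ge0 ?sqr_ge0 ?(sol_r_ge0 hsol).
set P1 := ipv _ _; set P2 := ipv _ _; set P3 := ip _ _.
have -> : P1 = K.
  apply: eq_Rintegral => x _.
  by rewrite /X_t !scale_vec2 !dotv_vec2 -/rt -/zt; ring.
have -> : P2 = \int[@lebesgue_measure R]_(x in unitI)
    (r x t * (A1 x t * d_rho rt x t + A2 x t * d_rho zt x t)).
  apply: eq_Rintegral => x /set_mem x01.
  have XE : X_rho r z x t = N x t *: vec2 (cos (theta x t)) (sin (theta x t)).
    by rewrite /X_rho scale_vec2; have [-> ->] := X_rho_polar x01 tT.
  rewrite -/(N x t) XE -scalemxAr surface_matrix_tangent.
  rewrite !scale_vec2 dotv_vec2 /A1 /A2 /g /dg /c /s; field.
  exact: N_neq0.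
have -> : P3 = \int[@lebesgue_measure R]_(x in unitI) (rt x t * (g x t * N x t)).
  by apply: eq_Rintegral => x _; rewrite mulrCA.
rewrite [X in X - _ <= 0]RintegralD; first last.
- by apply: continuous_unitI_integrable; exact: (box_continuous_rho cE2 tT).
- by apply: continuous_unitI_integrable; exact: (box_continuous_rho cE1 tT).
- exact: measurable_unitI.
set Q2 := (X in K + X + _ + _ - _ = 0); set Q1 := (X in K + _ + X + _ - _ = 0).
rewrite -/rt => E; rewrite -/Q1 -/Q2.
have : 0 <= eta^-1 * (r 1 t * rt 1 t * rt 1 t + r 0 t * rt 0 t * rt 0 t).
  have r0 x : x \in `[0, 1] -> 0 <= r x t * rt x t * rt x t.
    move=> x01; rewrite -mulrA -expr2 mulr_ge0 ?sqr_ge0//.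
    exact: (sol_r_ge0 hsol).
  by rewrite mulr_ge0 ?invr_ge0 ?(ltW eta_gt0)// addr_ge0// r0// in_itv/= ?lexx ler01.
set W := eta^-1 * _ in E *; lra.
Qed.

Lemma weak_solution_energy t1 t2 : 0 <= t1 -> t1 <= t2 -> t2 <= T ->
  energy gamma sigma r z theta t2 <= energy gamma sigma r z theta t1.
Proof.
pose J t := \int[@lebesgue_measure R]_(x in unitI) Eint x t.
pose B t := r 0 t * r 0 t - r 1 t * r 1 t.
have x0 : 0 \in `[(0:R), 1] by rewrite in_itv/= lexx ler01.
have x1 : 1 \in `[(0:R), 1] by rewrite in_itv/= lexx ler01.
have EE : energy gamma sigma r z theta = (fun t => 2 * pi * J t + sigma * pi * B t).
  apply/funext => t; rewrite /energy; congr (2 * pi * _ + sigma * pi * _).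
  by apply: eq_Rintegral => x _; rewrite /Eint mulrA.
pose dW t := 2 * pi * (\int[@lebesgue_measure R]_(x in unitI) Eint_t x t
  - sigma * (r 1 t * rt 1 t - r 0 t * rt 0 t)).
have DW (t : R) : t \in `]0, T[ ->
    is_derive t 1 (fun t => 2 * pi * J t + sigma * pi * B t) (dW t).
  move=> tT; have DJ := leibniz_is_derive cE cEt dE tT.
  have D0 := regular_is_derive_t rr x0 tT; have D1 := regular_is_derive_t rr x1 tT.
  have h0 := is_deriveM D0 D0; have h1 := is_deriveM D1 D1.
  have := is_deriveD (is_deriveZ (2 * pi) DJ)
     (is_deriveZ (sigma * pi) (is_deriveB h0 h1)) => h.
  by apply: is_derive_eq h _; rewrite /dW /GRing.scale/= -/rt; ring.
have cW : {within `[0, T], continuous (fun t => 2 * pi * J t + sigma * pi * B t)}.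
  have cJ := leibniz_continuous cE cEt dE.
  have c0 := box_continuous_t cr x0; have c1 := box_continuous_t cr x1.
  move=> t.
  have cB := continuousB (continuousM (c0 t) (c0 t)) (continuousM (c1 t) (c1 t)).
  exact: (continuousD (continuousM (@cst_continuous _ _ (2 * pi) t) (cJ t))
                      (continuousM (@cst_continuous _ _ (sigma * pi) t) cB)).
rewrite EE.
apply: (@ler0_derive1_nincr _ (fun t => 2 * pi * J t + sigma * pi * B t) 0 T _ _ cW).
- by move=> t tT; have [] := DW t tT.
- move=> t tT; rewrite derive1E; have [_ ->] := DW t tT.
  by rewrite /dW pmulr_rle0 ?mulr_gt0 ?pi_gt0// energy_dissipation.
Qed.

End conservation_and_dissipation.

Theorem theorem3p2 (R : realType) (q : nat) (gamma S : R -> R)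
    (eta sigma T : R) (r z theta mu : R -> R -> R)
    (hq : q = 0%N \/ q = 1%N) (heta : 0 < eta)
    (gamma_gt0 : forall x, 0 < gamma x) (gamma_C2 : C2 gamma)
    (gamma_even : forall x, gamma (- x) = gamma x)
    (gamma_periodic : periodic gamma (2 * pi))
    (S_periodic : periodic S (2 * pi))
    (hsol : weak_solution q gamma S eta sigma T r z theta mu) :
  (forall t, t \in `[0, T] -> volume r z t = volume r z 0) /\
  (forall t1 t, 0 <= t1 -> t1 <= t -> t <= T ->
     energy gamma sigma r z theta t <= energy gamma sigma r z theta t1
     /\ energy gamma sigma r z theta t1 <= energy gamma sigma r z theta 0).
Proof.
split=> [t tT|t1 t t1_ge0 t1t tT]; first exact: weak_solution_volume hsol t tT.
split; apply: (weak_solution_energy heta gamma_C2 gamma_periodic hsol) => //.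
exact: le_trans tT.
Qed.
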